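(* There does not exist a $13\times 13$ complex matrix $H$ all of whose entries are complex $10$th roots of unity and with $HH^\ast=13I_{13}$; that is, $\mathrm{BH}(13,10)=\emptyset$.
   Context: $\mathrm{BH}(n,q)$ denotes the set of $n\times n$ complex matrices with all entries complex $q$th roots of unity satisfying $HH^\ast=nI_n$, where $H^\ast$ is the conjugate transpose. *)

(* Defs.v *)
From mathcomp Require Import all_boot all_order all_algebra.
From mathcomp Require Import sesquilinear spectral.
From mathcomp Require Import classical_sets reals.
From mathcomp Require Import complex.

Set Implicit Arguments.
Unset Strict Implicit.
Unset Printing Implicit Defensive.

Import GRing.Theory Num.Theory.

Local Open Scope ring_scope.
Local Open Scope sesquilinear_scope.
Local Open Scope classical_set_scope.

(* H ^t* is the conjugate transpose, and q.-unity_root z means z ^+ q = 1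
   (z is not required to be primitive). *)
Definition BH (R : realType) (n q : nat) : set 'M[R[i]]_n :=
  [set H : 'M[R[i]]_n |
    (forall i j, q.-unity_root (H i j)) /\ H *m H ^t* = (n%:R)%:M].

Arguments BH : clear implicits.

(* Main.v *)
Require Import Defs.
From mathcomp Require Import all_boot all_order all_algebra.
From mathcomp Require Import classical_sets reals complex.
From mathcomp Require Import zify ring.

(** The determinant [d] of such an [H] lies in Z[z], [z] a primitive 5th root of
    unity, and [d * d^* = 13 ^ 13].  Since 13 has order 4 modulo 5, it is inert in
    Z[z]: if 13 divides [d * d^*] then 13 divides [d].  Hence the exponent of 13
    in [d * d^*] is even, a contradiction.

    Writing [d = a + b z + c z^2 + e z^3], one has [d * d^* = U + V (z + z^4)] with
    integral quadratic forms [U], [V], and inertness is the statement that [U] and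
    [V] have no nontrivial common zero modulo 13, which is a finite check. *)

Set Implicit Arguments.
Unset Strict Implicit.
Unset Printing Implicit Defensive.

Import Order.TTheory GRing.Theory Num.Theory.

Local Open Scope ring_scope.

(** The shared subtracted sum is the coefficient of [z^2 + z^3] in the norm, eliminated through
    [z^2 + z^3 = -1 - (z + z^4)]. *)
Definition normU (R : pzRingType) (a b c e : R) : R :=
  a ^+ 2 + b ^+ 2 + c ^+ 2 + e ^+ 2 - (a * c + b * e + e * a).

Definition normV (R : pzRingType) (a b c e : R) : R :=
  a * b + b * c + c * e - (a * c + b * e + e * a).

(** Evaluation at all [13^4] residue quadruples; negative terms are moved to the right so that the
    congruences stay in [nat]. *)
Lemma normUV_mod13_nat : forall a b c e : nat,
  (a < 13)%N -> (b < 13)%N -> (c < 13)%N -> (e < 13)%N ->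
  (a * a + b * b + c * c + e * e = a * c + b * e + e * a %[mod 13])%N ->
  (a * b + b * c + c * e = a * c + b * e + e * a %[mod 13])%N ->
  [/\ a = 0, b = 0, c = 0 & e = 0]%N.
Proof.
pose P (a b c e : nat) :=
  (a * a + b * b + c * c + e * e == a * c + b * e + e * a %[mod 13])%N
  && (a * b + b * c + c * e == a * c + b * e + e * a %[mod 13])%N
  ==> [&& a == 0, b == 0, c == 0 & e == 0]%N.
have check : all (fun a => all (fun b => all (fun c => all (P a b c)
    (iota 0 13)) (iota 0 13)) (iota 0 13)) (iota 0 13) by vm_compute.
move=> a b c e a13 b13 c13 e13 /eqP U0 /eqP V0.
have mem k : (k < 13)%N -> k \in iota 0 13 by rewrite mem_iota.
move: check => /allP/(_ _ (mem _ a13))/allP/(_ _ (mem _ b13)).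
move=> /allP/(_ _ (mem _ c13))/allP/(_ _ (mem _ e13)).
by rewrite /P U0 V0 => /and4P[/eqP-> /eqP-> /eqP-> /eqP->].
Qed.

Lemma int_divmod13 (a : int) : exists (q : int) (r : nat),
  (r < 13)%N /\ a = 13 * q + r%:Z.
Proof. by exists (a %/ 13)%Z, `|(a %% 13)%Z|%N; lia. Qed.

Lemma normUV_mod13 (a b c e m n : int) :
  normU a b c e = 13 * m -> normV a b c e = 13 * n ->
  exists a' b' c' e' : int,
    [/\ a = 13 * a', b = 13 * b', c = 13 * c' & e = 13 * e'].
Proof.
have [a' [ra [ra13 ->]]] := int_divmod13 a.
have [b' [rb [rb13 ->]]] := int_divmod13 b.
have [c' [rc [rc13 ->]]] := int_divmod13 c.
have [e' [re [re13 ->]]] := int_divmod13 e.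
move=> U13 V13; exists a', b', c', e'.
have modP (x y : nat) (k : int) : x%:Z - y%:Z = 13 * k -> x = y %[mod 13].
  by lia.
suff [-> -> -> ->] : [/\ ra = 0, rb = 0, rc = 0 & re = 0]%N by rewrite !addr0.
apply: normUV_mod13_nat => //.
(* The term subtracted from [m] is the cofactor of 13 in the expansion of [normU] at [13 * a' + ra]
   and so on: 13 times the form at the quotients, plus the polar form. The same scheme serves
   [normV]. *)
- apply: (modP _ _ (m
    - (13 * (a'^+2 + b'^+2 + c'^+2 + e'^+2 - (a' * c' + b' * e' + e' * a'))
       + 2 * (a' * ra%:Z + b' * rb%:Z + c' * rc%:Z + e' * re%:Z)
       - (a' * rc%:Z + c' * ra%:Z + b' * re%:Z + e' * rb%:Z
          + e' * ra%:Z + a' * re%:Z)))).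
  by rewrite mulrBr -U13 /normU !PoszD !PoszM; ring.
- apply: (modP _ _ (n
    - (13 * (a' * b' + b' * c' + c' * e' - (a' * c' + b' * e' + e' * a'))
       + (a' * rb%:Z + b' * ra%:Z + b' * rc%:Z + c' * rb%:Z
          + c' * re%:Z + e' * rc%:Z)
       - (a' * rc%:Z + c' * ra%:Z + b' * re%:Z + e' * rb%:Z
          + e' * ra%:Z + a' * re%:Z)))).
  by rewrite mulrBr -V13 /normV !PoszD !PoszM; ring.
Qed.

(** Descent: all four coordinates are divisible by 13, so both forms lose a factor 169 and the
    exponent drops by two, down to [13 = 169 * u]. *)
Lemma normUV_neq_odd_exp13 (k : nat) (a b c e : int) :
  normU a b c e = 13 ^+ k.*2.+1 -> normV a b c e <> 0.
Proof.
elim: k a b c e => [|k IHk] a b c e Uk V0.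
  have [||a' [b' [c' [e' [aE bE cE eE]]]]] := @normUV_mod13 a b c e 1 0.
  - by rewrite Uk.
  - by rewrite V0.
  have : normU a b c e = 169 * normU a' b' c' e'.
    by rewrite aE bE cE eE /normU; ring.
  by rewrite Uk expr1; lia.
have [||a' [b' [c' [e' [aE bE cE eE]]]]] :=
  @normUV_mod13 a b c e (13 ^+ k.*2.+2) 0.
- by rewrite Uk doubleS exprS.
- by rewrite V0.
apply: (IHk a' b' c' e').
  apply: (@mulfI _ (169 : int)) => //.
  have <- : normU a b c e = 169 * normU a' b' c' e'.
    by rewrite aE bE cE eE /normU; ring.
  by rewrite Uk doubleS !exprS; ring.
apply: (@mulfI _ (169 : int)) => //.
have <- : normV a b c e = 169 * normV a' b' c' e'.
  by rewrite aE bE cE eE /normV; ring.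
by rewrite V0 mulr0.
Qed.

(** For [n > 0] the 5-adic valuation would be even on the left and odd on the right. *)
Lemma sqr_eq5sqr (m n : nat) : (m ^ 2 = 5 * n ^ 2)%N -> n = 0.
Proof.
case: (posnP n) => // n_gt0 mn.
have m_gt0 : (0 < m)%N by rewrite lt0n; apply: contraTneq n_gt0 => m0; nia.
have := congr1 (logn 5) mn.
rewrite lognM ?expn_gt0 ?n_gt0 // !lognX (pfactorK 1) //.
by move: (logn 5 m) (logn 5 n) => i j; lia.
Qed.

(** Completing the square in this form of discriminant 5 reduces to the irrationality of the square
    root of 5. *)
Lemma golden_norm_eq0 (m n : int) : m ^+ 2 = m * n + n ^+ 2 -> n = 0.
Proof.
move=> mn; have sq : (2 * m - n) ^+ 2 = 5 * n ^+ 2 by nia.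
apply/eqP; rewrite -absz_eq0; apply/eqP.
by apply: (@sqr_eq5sqr `|(2 * m - n)%R|); lia.
Qed.

Section FifthRoot.

Variables (C : numClosedFieldType) (z : C).
Hypothesis z_root : 1 + z + z ^+ 2 + z ^+ 3 + z ^+ 4 = 0.

Let z4 : z ^+ 4 = - (1 + z + z ^+ 2 + z ^+ 3).
Proof. by apply/eqP; rewrite -subr_eq0 opprK addrC z_root. Qed.

Lemma fifth_root_exp5 : z ^+ 5 = 1.
Proof. by ring: z4. Qed.

Lemma fifth_root_conj : z^* = z ^+ 4.
Proof.
have z_norm : `|z| = 1.
  apply/eqP; rewrite -(@pexpr_eq1 _ _ 5) //.
  by rewrite -normrX fifth_root_exp5 normr1.
have z_neq0 : z != 0 by rewrite -normr_eq0 z_norm oner_neq0.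
apply: (mulfI z_neq0).
by rewrite -normCK z_norm expr1n -exprS fifth_root_exp5.
Qed.

Lemma fifth_root_prim : 5.-primitive_root z.
Proof.
have [m m_prim m5] := prim_order_exists (isT : (0 < 5)%N) fifth_root_exp5.
(* The order is 1 or 5; order 1 would give [z = 1] and turn [z_root] into [5 = 0]. *)
move: m5; rewrite dvdn_divisors // !inE => /orP[]/eqP mE;
  rewrite mE in m_prim => //.
have z1 : z = 1 by rewrite -(prim_expr_order m_prim).
have /eqP : 5%:R = 0 :> C by rewrite -z_root z1; ring.
by rewrite pnatr_eq0.
Qed.

Definition Zz (x : C) : Prop := exists a b c e : int,
  x = a%:~R + b%:~R * z + c%:~R * z ^+ 2 + e%:~R * z ^+ 3.

Lemma ZzD x y : Zz x -> Zz y -> Zz (x + y).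
Proof.
move=> [a [b [c [e ->]]]] [a' [b' [c' [e' ->]]]].
by exists (a + a'), (b + b'), (c + c'), (e + e'); rewrite !intrD; ring.
Qed.

Lemma ZzN x : Zz x -> Zz (- x).
Proof.
move=> [a [b [c [e ->]]]].
by exists (- a), (- b), (- c), (- e); rewrite !mulrNz; ring.
Qed.

Lemma Zz0 : Zz 0.
Proof. by exists 0, 0, 0, 0; rewrite !mul0r !addr0. Qed.

Lemma Zz1 : Zz 1.
Proof. by exists 1, 0, 0, 0; rewrite !mul0r !addr0. Qed.

Lemma ZzMz x : Zz x -> Zz (x * z).
Proof.
move=> [a [b [c [e ->]]]].
(* Coefficients shift up by one, and [e * z^4] folds back as [-e] on every basis element. *)
exists (- e), (a - e), (b - e), (c - e); rewrite !(intrD, mulrNz).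
have -> : (a%:~R + b%:~R * z + c%:~R * z ^+ 2 + e%:~R * z ^+ 3) * z =
  a%:~R * z + b%:~R * z ^+ 2 + c%:~R * z ^+ 3 + e%:~R * z ^+ 4 by ring.
by rewrite z4; ring.
Qed.

Lemma ZzMint x (k : int) : Zz x -> Zz (x * k%:~R).
Proof.
move=> [a [b [c [e ->]]]].
by exists (a * k), (b * k), (c * k), (e * k); rewrite !intrM; ring.
Qed.

Lemma ZzM x y : Zz x -> Zz y -> Zz (x * y).
Proof.
move=> Zx [a [b [c [e ->]]]].
have -> : x * (a%:~R + b%:~R * z + c%:~R * z ^+ 2 + e%:~R * z ^+ 3) =
  x * a%:~R + x * z * b%:~R + x * z * z * c%:~R + x * z * z * z * e%:~R by ring.
by do !apply: ZzD; apply: ZzMint; do ?apply: ZzMz.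
Qed.

Lemma ZzX x k : Zz x -> Zz (x ^+ k).
Proof.
by move=> Zx; elim: k => [|k IHk]; [exact: Zz1 | rewrite exprS; apply: ZzM].
Qed.

Lemma Zz_unity_root10 x : 10.-unity_root x -> Zz x.
Proof.
have Zz5 y : y ^+ 5 = 1 -> Zz y.
  move=> /(prim_rootP fifth_root_prim)[i ->].
  by apply: ZzX; rewrite -[z]mul1r; apply/ZzMz/Zz1.
(* Since [x^5] is 1 or -1, either [x] or [-x] is a fifth root of unity, hence a power of [z]. *)
move=> /unity_rootP; rewrite (exprM x 5 2) => /eqP; rewrite sqrf_eq1.
move=> /orP[/eqP/Zz5//|/eqP x5]; rewrite -[x]opprK; apply/ZzN/Zz5.
by rewrite exprNn x5; ring.
Qed.

Lemma Zz_det n (M : 'M[C]_n) : (forall i j, Zz (M i j)) -> Zz (\det M).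
Proof.
(* Leibniz expansion: a sum of signed products of entries. *)
move=> ZM; apply: big_ind => [||s _]; [exact: Zz0 | exact: ZzD |].
apply: ZzM; first by apply/ZzX/ZzN/Zz1.
by apply: big_ind => [||i _]; [exact: Zz1 | exact: ZzM | exact: ZM].
Qed.

Lemma Zz_mul_conj (a b c e : int) :
  let x := a%:~R + b%:~R * z + c%:~R * z ^+ 2 + e%:~R * z ^+ 3 in
  x * x^* = (normU a b c e)%:~R + (normV a b c e)%:~R * (z + z ^+ 4).
Proof.
rewrite /= !(rmorphD, rmorphM, rmorphXn, rmorph_int) /= fifth_root_conj.
rewrite /normU /normV !(intrD, mulrNz, intrM) -!exprM.
have -> : z ^+ (4 * 2) = z ^+ 3 by rewrite (exprD z 5 3) fifth_root_exp5 mul1r.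
have -> : z ^+ (4 * 3) = z ^+ 2.
  by rewrite (exprD z 10 2) (exprM z 5 2) fifth_root_exp5 expr1n mul1r.
have z5 := fifth_root_exp5.
ring: z5 z4.
Qed.

(** With [t = z + z^4] one has [t^2 = 1 - t], so [m = -n * t] yields [m^2 = m * n + n^2]. *)
Lemma int_golden_free (m n : int) :
  m%:~R + n%:~R * (z + z ^+ 4) = 0 -> m = 0 /\ n = 0.
Proof.
set t := z + z ^+ 4 => mnt.
have t2 : t ^+ 2 = 1 - t.
  have z5 := fifth_root_exp5; rewrite /t.
  ring: z5 z4.
have mE : m%:~R = - (n%:~R * t) by apply/eqP; rewrite -addr_eq0 mnt.
have n0 : n = 0.
  apply: (@golden_norm_eq0 m); apply/eqP; rewrite -(eqr_int C).
  by rewrite !(intrD, intrM, rmorphXn) /= mE; apply/eqP; ring: t2.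
split=> //; move: mE; rewrite n0 mul0r oppr0.
by move/eqP; rewrite intr_eq0 => /eqP.
Qed.

Lemma Zz_sqnorm_neq x k : Zz x -> x * x^* <> 13 ^+ k.*2.+1.
Proof.
move=> [a [b [c [e ->]]]]; rewrite Zz_mul_conj => xE.
have [] := @int_golden_free (normU a b c e - 13 ^+ k.*2.+1) (normV a b c e).
  by rewrite intrD mulrNz rmorphXn /= addrAC xE subrr.
by move/eqP; rewrite subr_eq0 => /eqP /normUV_neq_odd_exp13.
Qed.

End FifthRoot.

Lemma fifth_root_exists (C : numClosedFieldType) :
  exists z : C, 1 + z + z ^+ 2 + z ^+ 3 + z ^+ 4 = 0.
Proof.
(* Constant coefficients -1 encode [z^4 = -(1 + z + z^2 + z^3)]. *)
have [z zE] := solve_monicpoly (fun=> -1 : C) (isT : (0 < 4)%N).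
exists z; rewrite zE !big_ord_recl big_ord0 /bump /=; ring.
Qed.

Theorem mainTheorem9 (R : realType) : BH R 13 10 = (@set0 'M[R[i]]_13).
Proof.
rewrite -subset0 => H [H10 HH].
have [z z_root] := fifth_root_exists R[i].
(* The value 6 comes from [13 = 2 * 6 + 1], the exponent in the determinant [13^13] of the scalar
   matrix. *)
apply: (@Zz_sqnorm_neq _ z z_root (\det H) 6).
  by apply: Zz_det => // i j; apply: Zz_unity_root10.
have := congr1 determinant HH.
by rewrite det_mulmx det_map_mx det_tr det_scalar.
Qed.
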